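(* Let $\mu$ be a measure with $\mathrm{supp}(\mu)\subseteq\overline{\mathbb{D}}=\{z:|z|\le1\}$ and let $\mathcal{N}\subseteq\mathbb{N}$ be a subsequence such that $$\lim_{\substack{n\to\infty\\ n\in\mathcal{N}}}\kappa_n\kappa_{n-1}^{-1}=1.$$ Then $$\lim_{\substack{n\to\infty\\ n\in\mathcal{N}}}\frac{z\,p_{n-1}(z;\mu)}{p_n(z;\mu)}=1$$ uniformly on compact subsets of $\overline{\mathbb{C}}\setminus\overline{\mathbb{D}}$.
   Context: $\overline{\mathbb{C}}$ is the Riemann sphere. All measures are positive, finite, compactly supported Borel measures on $\mathbb{C}$ with infinite support. $p_n(z;\mu)=\kappa_n z^n+\cdots$, $\kappa_n>0$, is the degree-$n$ orthonormal polynomial of $\mu$: $\int \overline{p_n}\,p_m\,d\mu=\delta_{nm}$. The quotient is regarded as analytic at $\infty$, with value $\kappa_{n-1}/\kappa_n$ there. *)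

(* Defs.v *)
From HB Require Import structures.
From mathcomp Require Import all_boot all_order all_algebra.
From mathcomp Require Import all_classical all_reals all_analysis.
From mathcomp Require Export complex.

Set Implicit Arguments.
Unset Strict Implicit.
Unset Printing Implicit Defensive.

Import Order.TTheory GRing.Theory Num.Theory.
Import numFieldNormedType.Exports.

Local Open Scope classical_set_scope.
Local Open Scope ring_scope.
Local Open Scope complex_scope.

(* The usual topology of the complex plane is not declared by the libraries on
   R[i] itself, only on its regular-algebra alias. *)
HB.instance Definition _ (R : realType) := NormedModule.copy R[i] R[i]^o.

Definition borelC (R : realType) := g_sigma_algebraType (@open R[i]).

(* The integrals of the real and imaginary parts are the finite parts of
   extended-real integrals, so this is meaningful for integrable f only. *)
Definition integralC (R : realType) (mu : {measure set (borelC R) -> \bar R})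
    (f : R[i] -> R[i]) : R[i] :=
  Rintegral mu setT (fun z => complex.Re (f z)) +i*
  Rintegral mu setT (fun z => complex.Im (f z)).

Definition supp (R : realType) (mu : {measure set (borelC R) -> \bar R})
    : set R[i] :=
  [set z | forall U : set R[i], open U -> U z -> (0 < mu U)%E].

(* The order of R[i] only compares numbers with equal imaginary parts, so
   0 < lead_coef (p n) makes the leading coefficient a positive real.
   The degree of p n is (size (p n)).-1. *)
Definition orthonormal_polynomials (R : realType)
    (mu : {measure set (borelC R) -> \bar R}) (p : nat -> {poly R[i]}) : Prop :=
  (forall n, size (p n) = n.+1 /\ 0 < lead_coef (p n)) /\
  (forall n m,
     integralC mu (fun z => conjc (p n).[z] * (p m).[z]) = (n == m)%:R).

Definition riemann_sphere (R : realType) := one_point_compactification R[i].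

Definition closed_disk (R : realType) : set R[i] := [set z | `|z| <= 1].
Arguments closed_disk : clear implicits.

Definition exterior (R : realType) : set (riemann_sphere R) :=
  ~` (Some @` closed_disk R).
Arguments exterior : clear implicits.

(* z p_{n-1}(z) / p_n(z), with its analytic value at infinity (None); the
   value for n = 0 is irrelevant. *)
Definition opoly_ratio (R : realType) (p : nat -> {poly R[i]}) (n : nat)
    (w : riemann_sphere R) : R[i] :=
  if w is Some z then z * (p n.-1).[z] / (p n).[z]
  else lead_coef (p n.-1) / lead_coef (p n).

(* Main.v *)
(* Let [q = z p_{n-1} - p_n] and [k_n = kappa_{n-1} / kappa_n].  Orthogonality
   and [|w| <= 1] on the support give [int |q|^2 <= 2 - 2 k_n], which tends to 0.
   For [|z| > 1] the polynomial [(q(w) p_n(z) - q(z) p_n(w)) / (z - w)] in [w]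
   has degree less than [n], hence is orthogonal to [p_n]; therefore
     q(z) / p_n(z) = int conj(p_n) q / (z - w) / int |p_n|^2 / (z - w).
   The denominator has modulus at least [1 / (2 |z|)] because
   [Re (z / (z - w)) >= 1/2] for [|w| <= 1 < |z|], and the numerator is small
   because [q] is small in L^2, uniformly for [|z| >= 1 + d]. *)
Require Import Defs.
From mathcomp Require Import all_boot all_order all_algebra.
From mathcomp Require Import all_classical all_reals all_analysis.
From mathcomp Require Import measurable_realfun ring lra.
Import Order.TTheory GRing.Theory Num.Theory.
Import numFieldNormedType.Exports.
Local Open Scope classical_set_scope.
Local Open Scope ring_scope.
Local Open Scope complex_scope.
Set Implicit Arguments.
Unset Strict Implicit.
Unset Printing Implicit Defensive.

Local Notation Re := (@complex.Re _).
Local Notation Im := (@complex.Im _).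
Local Notation normc := (@ComplexField.Normc.normc _).
Local Notation D := (closed_disk _).

(** * The complex plane *)

Section geometry.
Variable R : realType.
Implicit Types z w : R[i].

(** The norm of [R[i]] takes values in [R[i]] itself. Passing to the real-valued [normc] moves all
    estimates to [R], where ordered-field reasoning applies. *)
Lemma normr_normc z : `|z| = (normc z)%:C.
Proof. by case: z. Qed.

Lemma closed_diskE w : closed_disk R w <-> normc w <= 1.
Proof. by rewrite /closed_disk /= normr_normc -(lecR (normc w) 1). Qed.

Lemma normc_sqr z : normc z ^+ 2 = Re z ^+ 2 + Im z ^+ 2.
Proof. by case: z => a b /=; rewrite sqr_sqrtr ?addr_ge0 ?sqr_ge0. Qed.

Lemma normc_ge0 z : 0 <= normc z.
Proof. by case: z => a b /=; exact: sqrtr_ge0. Qed.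

Lemma le_Re_normc z : `|Re z| <= normc z.
Proof.
rewrite -(@ler_pXn2r _ 2) ?nnegrE ?normc_ge0// normc_sqr real_normK ?num_real//.
by rewrite lerDl sqr_ge0.
Qed.

Lemma le_Im_normc z : `|Im z| <= normc z.
Proof.
rewrite -(@ler_pXn2r _ 2) ?nnegrE ?normc_ge0// normc_sqr real_normK ?num_real//.
by rewrite lerDr sqr_ge0.
Qed.

Lemma normc_le_ReIm z : normc z <= `|Re z| + `|Im z|.
Proof.
rewrite -(@ler_pXn2r _ 2) ?nnegrE ?normc_ge0 ?addr_ge0// normc_sqr.
by rewrite sqrrD !real_normK ?num_real// -addrA lerD2l lerDr mulrn_wge0.
Qed.

Lemma complex_ReD (z w : R[i]) : Re (z + w) = Re z + Re w.
Proof. by case: z w => ? ? []. Qed.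

Lemma complex_ImD (z w : R[i]) : Im (z + w) = Im z + Im w.
Proof. by case: z w => ? ? []. Qed.

Lemma complex_ReM (z w : R[i]) : Re (z * w) = Re z * Re w - Im z * Im w.
Proof. by case: z w => ? ? []. Qed.

Lemma complex_ImM (z w : R[i]) : Im (z * w) = Re z * Im w + Im z * Re w.
Proof. by case: z w => ? ? []. Qed.

Lemma conjcM_normc (z : R[i]) : conjc z * z = (normc z ^+ 2)%:C.
Proof.
rewrite normc_sqr; case: z => a b /=.
by apply/eqP; rewrite eq_complex /=; apply/andP; split; apply/eqP; ring.
Qed.

Lemma normc_conj (z : R[i]) : normc (conjc z) = normc z.
Proof. by case: z => a b /=; rewrite sqrrN. Qed.

Lemma normc_sub_ge z w : normc z - normc w <= normc (z - w).
Proof.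
by rewrite lerBlDr; have := le_normcD (z - w : Rcomplex R) w; rewrite subrK.
Qed.

(** A positive element of [R[i]] has zero imaginary part, so balls of real radius already generate
    the neighbourhoods. *)
Lemma nbhs_complexP z (A : set R[i]) :
  nbhs z A <-> exists2 e : R, 0 < e & forall w, normc (w - z) < e -> A w.
Proof.
split.
  move=> [[e e'] /=]; rewrite ltcE /= => /andP[/eqP -> e0] eA.
  by exists e => // w we; apply: eA; rewrite /= distrC normr_normc ltcR.
move=> [e e0 eA]; exists e%:C; first by rewrite /= ltcR.
by move=> w; rewrite /= distrC normr_normc ltcR; exact: eA.
Qed.

Lemma continuous_Re : continuous (Re : R[i] -> R).
Proof.
move=> z A /nbhs_ballP[e e0 eA]; apply/nbhs_complexP; exists e => // w we.
apply: eA; rewrite -ball_normE /= distrC; apply: le_lt_trans we.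
by apply: le_trans (le_Re_normc _); case: z w => [a b] [c d].
Qed.

Lemma continuous_Im : continuous (Im : R[i] -> R).
Proof.
move=> z A /nbhs_ballP[e e0 eA]; apply/nbhs_complexP; exists e => // w we.
apply: eA; rewrite -ball_normE /= distrC; apply: le_lt_trans we.
by apply: le_trans (le_Im_normc _); case: z w => [a b] [c d].
Qed.

Lemma continuous_Complex : continuous (fun x : R * R => x.1 +i* x.2).
Proof.
move=> [a b] A /nbhs_complexP[e e0 eA].
have e2 : 0 < e / 2 by rewrite divr_gt0.
exists (ball a (e / 2), ball b (e / 2)).
  by split; apply: nbhsx_ballx.
move=> [c d] /= []; rewrite -!ball_normE /= => ac bd; apply: eA.
apply: le_lt_trans (normc_le_ReIm _) _ => /=.
by rewrite [e]splitr ltrD// distrC.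
Qed.

(** Squares rather than disks, because a square is the continuous image of a product of two segments
    and so is compact. Their complements serve as neighbourhoods of infinity. *)
Definition complex_square (a : R) : set R[i] :=
  [set z | `|Re z| <= a /\ `|Im z| <= a].

Lemma compact_complex_square a : compact (complex_square a).
Proof.
have -> : complex_square a =
    (fun x : R * R => x.1 +i* x.2) @` (`[- a, a] `*` `[- a, a]).
  apply/seteqP; split => [[x y] [/= xa ya]|z [[x y] [/= xa ya] <-]].
    by exists (x, y) => //=; rewrite !in_itv /= -!ler_norml.
  by move: xa ya; rewrite !in_itv /= -!ler_norml.
apply: continuous_compact; first by apply: continuous_subspaceT; exact: continuous_Complex.
by apply: compact_setX; exact: segment_compact.
Qed.

Lemma closed_complex_square a : closed (complex_square a).
Proof.
have -> : complex_square a = (Re @^-1` `[- a, a]) `&` (Im @^-1` `[- a, a]).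
  by apply/seteqP; split => z /=; rewrite !in_itv /= -!ler_norml.
apply: closedI.
  by have /continuous_closedP := continuous_Re; apply; exact: interval_closed.
by have /continuous_closedP := continuous_Im; apply; exact: interval_closed.
Qed.

Lemma measurable_fun_Re : measurable_fun setT (Re : borelC R -> R).
Proof.
apply: (measurability _ (RGenOpens.measurableE R)).
move=> _ [_ [a [b ->] <-]]; rewrite setTI; apply: sub_sigma_algebra.
have /continuousP := continuous_Re; apply; exact: interval_open.
Qed.

Lemma measurable_fun_Im : measurable_fun setT (Im : borelC R -> R).
Proof.
apply: (measurability _ (RGenOpens.measurableE R)).
move=> _ [_ [a [b ->] <-]]; rewrite setTI; apply: sub_sigma_algebra.
have /continuousP := continuous_Im; apply; exact: interval_open.
Qed.

(** The line splits into [{0}], where every function is measurable, and its open complement, where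
    inversion is continuous. *)
Lemma measurable_inv (A : set R) : measurable_fun A (@GRing.inv R).
Proof.
apply: measurable_funTS; rewrite -(setUv [set 0 : R]).
apply/measurable_funU; [exact: measurable_set1|by apply: measurableC; exact: measurable_set1|].
split; first exact: measurable_fun_set1.
apply: open_continuous_measurable_fun.
  by apply: closed_openC; exact: closed_eq.
by move=> x; rewrite inE /= => /eqP x0; exact: inv_continuous.
Qed.
End geometry.

(** * Integration over the disk *)

Section null_sets.
Variable R : realType.
Variable mu : {finite_measure set (borelC R) -> \bar R}.

Lemma measurable_closed_disk : measurable (D : set (borelC R)).
Proof.
have -> : D = setT `&` (fun w : R[i] => Re w ^+ 2 + Im w ^+ 2) @^-1` `]-oo, 1].
  apply/seteqP; split => w; rewrite setTI /= in_itv /= -normc_sqr.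
    by move/closed_diskE => w1; rewrite expr_le1 ?normc_ge0.
  by rewrite expr_le1 ?normc_ge0// => w1; exact/closed_diskE.
apply: measurable_funD => //; apply: measurable_funX.
  exact: measurable_fun_Re.
exact: measurable_fun_Im.
Qed.

(** Open rectangles with rational sides form a countable base of the plane. *)
Definition rat_box (t : rat * rat * (rat * rat)) : set (borelC R) :=
  [set w : R[i] | ratr t.1.1 < Re w < ratr t.1.2 /\ ratr t.2.1 < Im w < ratr t.2.2].

Lemma measurable_rat_box t : measurable (rat_box t).
Proof.
have -> : rat_box t = (Re @^-1` `]ratr t.1.1, ratr t.1.2[)
   `&` (Im @^-1` `]ratr t.2.1, ratr t.2.2[).
  by apply/seteqP; split => w /=; rewrite !in_itv.
apply: measurableI; rewrite -[X in measurable X]setTI.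
  exact: measurable_fun_Re.
exact: measurable_fun_Im.
Qed.

Lemma open_rat_box (z : R[i]) (U : set R[i]) : open U -> U z ->
  exists t, rat_box t z /\ rat_box t `<=` U.
Proof.
move=> oU Uz; have /nbhs_complexP[e e0 eU] : nbhs z U by exact: open_nbhs_nbhs.
(* Each coordinate may vary by [e / 2], since [normc] is at most the sum of the absolute values of
   the two coordinates. *)
have e2 : 0 < e / 2 by rewrite divr_gt0.
have [a az] := @rat_in_itvoo _ (Re z - e / 2) (Re z) ltac:(lra).
have [b bz] := @rat_in_itvoo _ (Re z) (Re z + e / 2) ltac:(lra).
have [c cz] := @rat_in_itvoo _ (Im z - e / 2) (Im z) ltac:(lra).
have [d dz] := @rat_in_itvoo _ (Im z) (Im z + e / 2) ltac:(lra).
move: az bz cz dz; rewrite !in_itv /= => /andP[? ?] /andP[? ?] /andP[? ?] /andP[? ?].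
exists ((a, b), (c, d)); split; first by split; apply/andP; split.
move=> w [] /= /andP[? ?] /andP[? ?]; apply: eU.
apply: le_lt_trans (normc_le_ReIm _) _.
have -> : Re (w - z) = Re w - Re z by case: (w) (z) => ? ? [].
have -> : Im (w - z) = Im w - Im z by case: (w) (z) => ? ? [].
have : `|Re w - Re z| < e / 2 by rewrite ltr_norml; apply/andP; split; lra.
have : `|Im w - Im z| < e / 2 by rewrite ltr_norml; apply/andP; split; lra.
lra.
Qed.

(** A point off the support lies in an open null set, hence in a null rational box. These boxes are
    countably many, so their union is null. *)
Lemma supp_setC_negligible : mu.-negligible (~` supp mu).
Proof.
(* Enumerates the null boxes; integers coding no box, and boxes of positive measure, contribute the
   empty set. *)
pose F (n : nat) : set (borelC R) := if unpickle n is Some t then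
  (if mu (rat_box t) == 0%E then rat_box t else set0) else set0.
apply: (@negligibleS _ _ _ mu (\bigcup_n F n)); last first.
  apply: negligible_bigcup => n; rewrite /F.
  case: unpickle => [t|]; last exact: negligible_set0.
  case: ifPn => [/eqP mut|_]; last exact: negligible_set0.
  by apply/negligibleP => //; exact: measurable_rat_box.
move=> z /existsNP[U /not_implyP[oU /not_implyP[Uz /negP]]].
rewrite -leNgt measure_le0 => /eqP muU.
have [t [tz tU]] := open_rat_box oU Uz.
have mut : mu (rat_box t) = 0%E.
  apply: (subset_measure0 _ _ tU muU); first exact: measurable_rat_box.
  exact: sub_sigma_algebra.
exists (pickle t); first exact: I.
by rewrite /F pickleK mut eqxx.
Qed.

End null_sets.

(** * Integrals of functions bounded on the closed disk *)

Section integration.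
Variable R : realType.
Variable mu : {finite_measure set (borelC R) -> \bar R}.
Hypothesis mu_disk : supp mu `<=` D.

Lemma measurable_setC_closed_disk : measurable (~` (D : set (borelC R))).
Proof. by apply: measurableC; exact: measurable_closed_disk. Qed.

Lemma measure_setC_closed_disk : mu (~` D) = 0%E.
Proof.
apply/(negligibleP mu measurable_setC_closed_disk).
by apply: negligibleS (supp_setC_negligible mu); exact: subsetC.
Qed.

(** The bound is asked on the disk only, so that polynomials qualify. It still gives integrability
    over the whole plane, as [mu] does not charge the complement of the disk. *)
Definition disk_bounded (f : borelC R -> R) :=
  measurable_fun setT f /\ exists M, forall w, D w -> `|f w| <= M.

Lemma disk_bounded_integrable f :
  disk_bounded f -> mu.-integrable setT (EFin \o f).
Proof.
move=> [mf [M fM]]; apply/(@negligible_integrable _ (borelC R) R mu setT (~` D)).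
- exact: measurable_setC_closed_disk.
- exact: measurableT.
- exact/measurable_EFinP.
- exact: measure_setC_closed_disk.
rewrite setTD setCK; apply: measurable_bounded_integrable.
- exact: measurable_closed_disk.
- by rewrite ltey_eq fin_num_measure//; exact: measurable_closed_disk.
- exact: measurable_funTS.
exists M; split; first exact: num_real.
by move=> x Mx w Dw; apply: le_trans (fM _ Dw) (ltW Mx).
Qed.

Lemma Rintegral_disk f : disk_bounded f ->
  Rintegral mu setT f = Rintegral mu D f.
Proof.
move=> bf; rewrite /Rintegral.
rewrite (@negligible_integral _ (borelC R) R mu setT (~` D)) ?setTD ?setCK//.
- exact: measurable_setC_closed_disk.
- exact: disk_bounded_integrable.
- exact: measure_setC_closed_disk.
Qed.

Lemma le_Rintegral_disk f g : disk_bounded f -> disk_bounded g ->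
  (forall w, D w -> f w <= g w) -> Rintegral mu setT f <= Rintegral mu setT g.
Proof.
move=> bf bg fg; rewrite !Rintegral_disk//.
have int h : disk_bounded h -> mu.-integrable D (EFin \o h).
  move=> /disk_bounded_integrable; apply: integrableS => //.
  exact: measurable_closed_disk.
by apply: le_Rintegral => //; [exact: measurable_closed_disk|exact: int|exact: int].
Qed.

Definition disk_boundedC (f : R[i] -> R[i]) :=
  [/\ measurable_fun setT (Re \o f : borelC R -> R),
      measurable_fun setT (Im \o f : borelC R -> R) &
      exists M, forall w, D w -> normc (f w) <= M].

Lemma disk_bounded_Re f : disk_boundedC f -> disk_bounded (Re \o f).
Proof.
move=> [mr mi [M fM]]; split => //; exists M => w /fM; apply: le_trans.
exact: le_Re_normc.
Qed.

Lemma disk_bounded_Im f : disk_boundedC f -> disk_bounded (Im \o f).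
Proof.
move=> [mr mi [M fM]]; split => //; exists M => w /fM; apply: le_trans.
exact: le_Im_normc.
Qed.

Lemma disk_boundedC_cst c : disk_boundedC (cst c).
Proof. by split; [exact: measurable_cst|exact: measurable_cst|exists (normc c)]. Qed.

Lemma disk_boundedC_id : disk_boundedC id.
Proof.
split; [exact: measurable_fun_Re|exact: measurable_fun_Im|].
by exists 1 => w /closed_diskE.
Qed.

Lemma disk_boundedC_add f g : disk_boundedC f -> disk_boundedC g ->
  disk_boundedC (fun w => f w + g w).
Proof.
move=> [mrf mif [M fM]] [mrg mig [N gN]]; split.
- rewrite (_ : _ \o _ = (Re \o f) \+ (Re \o g)); first exact: measurable_funD.
  by apply/funext => w; rewrite /= complex_ReD.
- rewrite (_ : _ \o _ = (Im \o f) \+ (Im \o g)); first exact: measurable_funD.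
  by apply/funext => w; rewrite /= complex_ImD.
exists (M + N) => w Dw; apply: le_trans (le_normcD _ _) _.
by rewrite lerD ?fM ?gN.
Qed.

Lemma disk_boundedC_mul f g : disk_boundedC f -> disk_boundedC g ->
  disk_boundedC (fun w => f w * g w).
Proof.
move=> [mrf mif [M fM]] [mrg mig [N gN]]; split.
- rewrite (_ : _ \o _ = (Re \o f) \* (Re \o g) \- (Im \o f) \* (Im \o g)).
    by apply: measurable_funB; exact: measurable_funM.
  by apply/funext => w; rewrite /= complex_ReM.
- rewrite (_ : _ \o _ = (Re \o f) \* (Im \o g) \+ (Im \o f) \* (Re \o g)).
    by apply: measurable_funD; exact: measurable_funM.
  by apply/funext => w; rewrite /= complex_ImM.
exists (M * N) => w Dw; rewrite Normc.normcM.
by rewrite ler_pM ?normc_ge0 ?fM ?gN.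
Qed.

Lemma disk_boundedC_conj f : disk_boundedC f -> disk_boundedC (fun w => (f w)^*).
Proof.
move=> [mrf mif [M fM]]; split.
- rewrite (_ : _ \o _ = Re \o f)//.
  by apply/funext => w /=; case: (f w).
- rewrite (_ : _ \o _ = \- (Im \o f)); first exact: measurable_funN.
  by apply/funext => w /=; case: (f w).
exists M => w /fM; case: (f w) => a b /=; by rewrite sqrrN.
Qed.

Lemma disk_boundedC_horner (p : {poly R[i]}) : disk_boundedC (fun w => p.[w]).
Proof.
elim/poly_ind: p => [|p c IH].
  rewrite (_ : (fun _ => _) = cst 0); first exact: disk_boundedC_cst.
  by apply/funext => w; rewrite horner0.
rewrite (_ : (fun _ => _) = fun w => p.[w] * w + c).
  apply: disk_boundedC_add; last exact: disk_boundedC_cst.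
  by apply: disk_boundedC_mul => //; exact: disk_boundedC_id.
by apply/funext => w; rewrite !hornerE.
Qed.

(** The inverse is the conjugate divided by the squared modulus. With the convention [0^-1 = 0] this
    formula holds at the zeros of [f] too. *)
Lemma measurable_fun_invc f : measurable_fun setT (Re \o f : borelC R -> R) ->
  measurable_fun setT (Im \o f : borelC R -> R) ->
  measurable_fun setT (Re \o (fun w => (f w)^-1) : borelC R -> R) /\
  measurable_fun setT (Im \o (fun w => (f w)^-1) : borelC R -> R).
Proof.
move=> mr mi.
have mV : measurable_fun setT
    ((fun x => x^-1) \o ((Re \o f) \* (Re \o f) \+ (Im \o f) \* (Im \o f))
      : borelC R -> R).
  apply: measurableT_comp; first exact: measurable_inv.
  by apply: measurable_funD; exact: measurable_funM.
split.
- rewrite (_ : _ \o _ = (Re \o f) \* ((fun x => x^-1) \o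
    ((Re \o f) \* (Re \o f) \+ (Im \o f) \* (Im \o f)))).
    exact: measurable_funM.
  by apply/funext => w /=; case: (f w).
- rewrite (_ : _ \o _ = \- ((Im \o f) \* ((fun x => x^-1) \o
    ((Re \o f) \* (Re \o f) \+ (Im \o f) \* (Im \o f))))).
    by apply: measurable_funN; exact: measurable_funM.
  by apply/funext => w /=; case: (f w).
Qed.

Lemma integralCD f g : disk_boundedC f -> disk_boundedC g ->
  integralC mu (fun w => f w + g w) = integralC mu f + integralC mu g.
Proof.
move=> bf bg; rewrite /integralC.
under eq_Rintegral do rewrite complex_ReD.
under [X in _ +i* X]eq_Rintegral do rewrite complex_ImD.
by rewrite !RintegralD//; apply: disk_bounded_integrable;
  (exact: disk_bounded_Re || exact: disk_bounded_Im).
Qed.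

Lemma integralCMl c f : disk_boundedC f ->
  integralC mu (fun w => c * f w) = c * integralC mu f.
Proof.
move=> bf; have ir := disk_bounded_integrable (disk_bounded_Re bf).
have ii := disk_bounded_integrable (disk_bounded_Im bf).
have iZ (a : R) g : mu.-integrable setT (EFin \o g) ->
    mu.-integrable setT (EFin \o (fun w => a * g w)).
  by move=> ig; apply: (@integrableZl _ _ _ mu setT measurableT a (EFin \o g)).

rewrite /integralC.
under eq_Rintegral do rewrite complex_ReM.
under [X in _ +i* X]eq_Rintegral do rewrite complex_ImM.
rewrite RintegralB ?RintegralD//; try exact: iZ.
by rewrite !RintegralZl//; case: c.
Qed.

(** Identities involving the kernel [(z - w)^-1] can fail at [w = z], where the inverse takes its
    default value; for [z] outside the disk, agreement on the disk is enough. *)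
Lemma eq_integralC_disk f g : disk_boundedC f -> disk_boundedC g ->
  (forall w, D w -> f w = g w) -> integralC mu f = integralC mu g.
Proof.
move=> bf bg fg; rewrite /integralC.
by congr (_ +i* _); apply/eqP; rewrite eq_le; apply/andP; split;
  apply: le_Rintegral_disk;
  do ?[exact: disk_bounded_Re | exact: disk_bounded_Im];
  move=> w /fg ->.
Qed.

(** The real and imaginary parts are each bounded by the integral of [g], whence the factor 2. *)
Lemma normc_integralC_le f g : disk_boundedC f -> disk_bounded g ->
  (forall w, D w -> normc (f w) <= g w) ->
  normc (integralC mu f) <= 2 * Rintegral mu setT g.
Proof.
have bounded_norm (h : borelC R -> R) : disk_bounded h -> disk_bounded (fun w => `|h w|).
  move=> [mh [M hM]]; split; first exact: measurableT_comp.
  by exists M => w /hM; rewrite normr_id.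
move=> bf bg fg; apply: le_trans (normc_le_ReIm _) _.
have le_part (h : borelC R -> R) : disk_bounded h -> (forall w, `|h w| <= normc (f w)) ->
    `|Rintegral mu setT h| <= Rintegral mu setT g.
  move=> bh hf; apply: (@le_trans _ _ (Rintegral mu setT (fun w => `|h w|))).
    by apply: le_normr_Rintegral => //; exact: disk_bounded_integrable.
  apply: le_Rintegral_disk => //; first exact: bounded_norm.
  by move=> w /fg; exact: le_trans.
rewrite mulr_natl mulr2n lerD// le_part//.
- exact: disk_bounded_Re.
- by move=> w; exact: le_Re_normc.
- exact: disk_bounded_Im.
- by move=> w; exact: le_Im_normc.
Qed.
End integration.

(** * The Cauchy kernel with pole outside the disk *)

Section kernel.
Variable R : realType.
Implicit Types z w : R[i].

(** On the disk [|z - w| >= |z| - 1 > 0]. *)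
Lemma disk_boundedC_cauchy z : 1 < normc z -> disk_boundedC (fun w => (z - w)^-1).
Proof.
move=> z1.
have [M1 M2 _] : disk_boundedC (fun w => z + (-1) * w).
  apply: disk_boundedC_add; first exact: disk_boundedC_cst.
  by apply: disk_boundedC_mul; [exact: disk_boundedC_cst|exact: disk_boundedC_id].
have E : (fun w => (z - w)^-1) = (fun w => (z + (-1) * w)^-1).
  by apply/funext => w; rewrite mulN1r.
have [V1 V2] := measurable_fun_invc M1 M2.
split; first by rewrite E.
  by rewrite E.
exists (normc z - 1)^-1 => w /closed_diskE w1.
rewrite Normc.normcV lef_pV2 ?posrE; last 2 first.
- by apply: lt_le_trans (normc_sub_ge _ _); rewrite subr_gt0; exact: le_lt_trans z1.
- by rewrite subr_gt0.
by apply: le_trans (normc_sub_ge _ _); rewrite lerD2l lerN2.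
Qed.

(** With [n2 = |z - w|^2], the real part equals [1/2 + (|z|^2 - |w|^2) / (2 n2)]. *)
Lemma Re_cauchy_ge z w : D w -> 1 < normc z -> 1 / 2 <= Re (z * (z - w)^-1).
Proof.
move=> /closed_diskE w1 z1.
have : normc w ^+ 2 <= normc z ^+ 2.
  by rewrite ler_pXn2r ?nnegrE ?normc_ge0//; apply: le_trans w1 (ltW z1).
have : 0 < normc (z - w) ^+ 2.
  rewrite exprn_gt0//; apply: lt_le_trans (normc_sub_ge _ _).
  by rewrite subr_gt0; exact: le_lt_trans z1.
rewrite !normc_sqr; case: z {z1} => a b; case: w {w1} => c d /=.
set n2 := _ + _ => n0 h.
have -> : a * ((a - c) / n2) - b * - ((b - d) / n2) =
  (a * (a - c) + b * (b - d)) / n2.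
  by ring.
by rewrite ler_pdivlMr// /n2; nra.
Qed.

Lemma disk_boundedD (f g : borelC R -> R) : disk_bounded f -> disk_bounded g ->
  disk_bounded (fun w => f w + g w).
Proof.
move=> [mf [M fM]] [mg [N gN]]; split; first exact: measurable_funD.
exists (M + N) => w Dw; apply: le_trans (ler_normD _ _) _.
by rewrite lerD ?fM ?gN.
Qed.

Lemma disk_boundedZ c (f : borelC R -> R) : disk_bounded f ->
  disk_bounded (fun w => c * f w).
Proof.
move=> [mf [M fM]]; split; first by apply: measurable_funM.
exists (`|c| * M) => w Dw; rewrite normrM.
by rewrite ler_wpM2l ?fM.
Qed.

Lemma disk_bounded_normc_sqr f : disk_boundedC f ->
  disk_bounded (fun w => normc (f w) ^+ 2).
Proof.
move=> bf; rewrite (_ : (fun _ => _) = Re \o (fun w => conjc (f w) * f w)).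
  by apply: disk_bounded_Re; apply: disk_boundedC_mul => //; exact: disk_boundedC_conj.
by apply/funext => w /=; rewrite conjcM_normc.
Qed.
End kernel.

(** * Orthonormal polynomials outside the disk *)

(** Used with [P], [Q] the values of [p n], [q] at [z], with [a], [b] their values at [w], and [c]
    the conjugate of [a]. The sign [-1] comes from dividing [w - z] by [z - w]. *)
Lemma div_difference_identity (F : fieldType) (P Q a b c h z w : F) :
  z - w != 0 -> P * b - Q * a = h * (w - z) ->
  P * (c * b * (z - w)^-1) + - Q * (c * a * (z - w)^-1) = -1 * (c * h).
Proof.
move=> zw E; transitivity (c * (P * b - Q * a) / (z - w)); first by ring.
by rewrite E; field.
Qed.

Section orthonormal.
Variable R : realType.
Variable mu : {finite_measure set (borelC R) -> \bar R}.
Hypothesis mu_disk : supp mu `<=` D.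
Variable p : nat -> {poly R[i]}.
Hypothesis p_orthonormal : orthonormal_polynomials mu p.

Let size_p n : size (p n) = n.+1.
Proof. by case: p_orthonormal => /(_ n)[]. Qed.

Let lead_p n : 0 < lead_coef (p n).
Proof. by case: p_orthonormal => /(_ n)[]. Qed.

Let bounded_conjM (f g : R[i] -> R[i]) : disk_boundedC f -> disk_boundedC g ->
  disk_boundedC (fun w => conjc (f w) * g w).
Proof. by move=> bf bg; apply: disk_boundedC_mul => //; exact: disk_boundedC_conj. Qed.

(** Induction on a bound [m] for the size of [h]: subtracting a multiple of [p m] removes the
    coefficient of degree [m], and [p m] is orthogonal to [p n] because [m < n]. *)
Lemma orthonormal_orthogonal n (h : {poly R[i]}) : (size h <= n)%N ->
  integralC mu (fun w => conjc (p n).[w] * h.[w]) = 0.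
Proof.
suff H m : (m <= n)%N -> forall h : {poly R[i]}, (size h <= m)%N ->
    integralC mu (fun w => conjc (p n).[w] * h.[w]) = 0 by exact: H.
elim: m => [|m IH] mn {}h.
  rewrite size_poly_leq0 => /eqP ->.
  rewrite (_ : (fun _ => _) = fun w => 0 * (p n).[w]).
    by rewrite integralCMl ?mul0r//; exact: disk_boundedC_horner.
  by apply/funext => w; rewrite horner0 mulr0 mul0r.
move=> hm; pose c := h`_m / lead_coef (p m).
have lm : lead_coef (p m) != 0 by rewrite gt_eqF.
have sh : (size (h - c *: p m)%R <= m)%N.
  apply/leq_sizeP => j; rewrite leq_eqVlt => /predU1P[<-|mj].
    rewrite coefB coefZ /c [lead_coef _]lead_coefE size_p /=.
    by move: lm; rewrite lead_coefE size_p /= => lm; rewrite divfK ?subrr.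
  rewrite coefB coefZ [h`_j]nth_default ?(leq_trans hm)//.
  by rewrite nth_default ?size_p// mulr0 subr0.
rewrite (_ : (fun _ => _) = fun w => conjc (p n).[w] * (h - c *: p m).[w]
   + c * (conjc (p n).[w] * (p m).[w])); last first.
  by apply/funext => w; rewrite hornerD hornerN hornerZ mulrBr mulrCA subrK.
have bp k := disk_boundedC_horner (p k).
rewrite integralCD//; last 2 first.
- by apply: bounded_conjM => //; exact: disk_boundedC_horner.
- by apply: disk_boundedC_mul; [exact: disk_boundedC_cst|exact: bounded_conjM].
rewrite (IH (ltnW mn) _ sh) add0r integralCMl//; last exact: bounded_conjM.
by case: p_orthonormal => _ ->; rewrite gtn_eqF ?mulr0.
Qed.

Lemma orthonormal_norm n : Rintegral mu setT (fun w => normc (p n).[w] ^+ 2) = 1.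
Proof.
case: p_orthonormal => _ /(_ n n) /(congr1 Re); rewrite eqxx /= => <-.
by apply: eq_Rintegral => w _; rewrite conjcM_normc.
Qed.

(** The cross-multiplied form needs no nonvanishing of [(p n).[z]], so it can serve to prove that
    nonvanishing. *)
Lemma cauchy_quotient n (q : {poly R[i]}) z : (size q <= n.+1)%N -> 1 < normc z ->
  (p n).[z] * integralC mu (fun w => conjc (p n).[w] * q.[w] * (z - w)^-1) =
  q.[z] * integralC mu (fun w => conjc (p n).[w] * (p n).[w] * (z - w)^-1).
Proof.
move=> sq z1; pose r := (p n).[z] *: q - q.[z] *: p n.
have /factor_theorem[h rE] : root r z by rewrite rootE !hornerE; apply/eqP; ring.
have sh : (size h <= n)%N.
  have [->|h0] := eqVneq h 0; first by rewrite size_poly0.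
  have : (size r <= n.+1)%N.
    apply: leq_trans (size_polyD _ _) _; rewrite size_polyN geq_max.
    by rewrite !(leq_trans (size_scale_leq _ _))// size_p.
  by rewrite rE size_Mmonic ?monicXsubC// size_XsubC addn2.
have bp := disk_boundedC_horner (p n).
have bq := disk_boundedC_horner q.
have bh := disk_boundedC_horner h.
have bk := disk_boundedC_cauchy z1.
have bN : disk_boundedC (fun w => conjc (p n).[w] * q.[w] * (z - w)^-1).
  by apply: disk_boundedC_mul => //; exact: bounded_conjM.
have bD : disk_boundedC (fun w => conjc (p n).[w] * (p n).[w] * (z - w)^-1).
  by apply: disk_boundedC_mul => //; exact: bounded_conjM.
have bZ c f : disk_boundedC f -> disk_boundedC (fun w => c * f w).
  by move=> ?; apply: disk_boundedC_mul => //; exact: disk_boundedC_cst.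
apply/eqP; rewrite -subr_eq0 -mulNr -!integralCMl// -integralCD//; [|exact: bZ..].
(* The right-hand [0] becomes [-1] times the vanishing integral of the conjugate of [p n] against
   [h]; it then suffices to compare integrands on the disk. *)
apply/eqP; rewrite -[RHS](mulr0 (-1)) -(orthonormal_orthogonal sh).
rewrite -integralCMl//; last exact: bounded_conjM.
apply: eq_integralC_disk => //.
- by apply: disk_boundedC_add; exact: bZ.
- by apply: bZ; exact: bounded_conjM.
move=> w /closed_diskE w1.
have zw : z - w != 0.
  by apply/eqP => /subr0_eq zw; move: w1; rewrite -zw leNgt z1.
apply: div_difference_identity => //.
have : r.[w] = h.[w] * (w - z) by rewrite rE !hornerE.
by rewrite /r hornerD hornerN !hornerZ.
Qed.

(** The integral times [z] has real part equal to the integral of [|p_n(w)|^2 Re (z / (z - w))],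
    which is at least half the integral of [|p_n|^2]. *)
Lemma cauchy_denominator_ge n z : 1 < normc z ->
  1 / 2 <= normc z *
    normc (integralC mu (fun w => conjc (p n).[w] * (p n).[w] * (z - w)^-1)).
Proof.
move=> z1; rewrite -Normc.normcM.
apply: le_trans (le_trans (ler_norm _) (le_Re_normc _)).
have bp := disk_boundedC_horner (p n).
have bD : disk_boundedC (fun w => conjc (p n).[w] * (p n).[w] * (z - w)^-1).
  apply: disk_boundedC_mul; first exact: bounded_conjM.
  exact: disk_boundedC_cauchy.
have bp2 := disk_bounded_normc_sqr bp.
have -> : 1 / 2 = Rintegral mu setT (fun w => 1 / 2 * normc (p n).[w] ^+ 2).
  by rewrite RintegralZl ?orthonormal_norm ?mulr1//; exact: disk_bounded_integrable.
rewrite -integralCMl//.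
apply: le_Rintegral_disk => //.
- exact: disk_boundedZ.
- apply: disk_bounded_Re; apply: disk_boundedC_mul => //; exact: disk_boundedC_cst.
move=> w Dw; have h := Re_cauchy_ge Dw z1.
rewrite [X in _ <= X](_ : _ = normc (p n).[w] ^+ 2 * Re (z * (z - w)^-1)).
  by rewrite mulrC; apply: ler_wpM2l; rewrite ?sqr_ge0.
by rewrite /= conjcM_normc mulrCA complex_ReM mul0r subr0.
Qed.

(** A weighted pointwise AM-GM inequality replaces Cauchy-Schwarz:
    [|p_n| |q| <= e/2 |p_n|^2 + |q|^2 / (2 e)], and the right side integrates to at most [e]. *)
Lemma cauchy_numerator_le n (q : {poly R[i]}) z (e : R) : 1 < normc z -> 0 < e ->
  Rintegral mu setT (fun w => normc q.[w] ^+ 2) <= e ^+ 2 ->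
  normc (integralC mu (fun w => conjc (p n).[w] * q.[w] * (z - w)^-1)) <=
  2 * e / (normc z - 1).
Proof.
move=> z1 e0 qe.
have bp := disk_boundedC_horner (p n).
have bq := disk_boundedC_horner q.
have bp2 := disk_bounded_normc_sqr bp.
have bq2 := disk_bounded_normc_sqr bq.
have bk := disk_boundedC_cauchy z1.
(* The AM-GM weights, multiplied by the bound [1 / (|z| - 1)] for the kernel. *)
pose a := (normc z - 1)^-1 * (e / 2).
pose b := (normc z - 1)^-1 * (e^-1 / 2).
have d0 : 0 < normc z - 1 by rewrite subr_gt0.
have b0 : 0 <= b by rewrite /b !mulr_ge0 ?invr_ge0 ?ltW.
apply: (@le_trans _ _ (2 * Rintegral mu setT
  (fun w => a * normc (p n).[w] ^+ 2 + b * normc q.[w] ^+ 2))).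
  apply: normc_integralC_le => //.
  - by apply: disk_boundedC_mul => //; exact: bounded_conjM.
  - by apply: disk_boundedD; exact: disk_boundedZ.
  move=> w /closed_diskE w1.
  rewrite !Normc.normcM normc_conj Normc.normcV.
  set x := normc (p n).[w]; set y := normc q.[w].
  have x0 : 0 <= x by exact: normc_ge0.
  have y0 : 0 <= y by exact: normc_ge0.
  have dw : normc z - 1 <= normc (z - w).
    by apply: le_trans (normc_sub_ge _ _); rewrite lerD2l lerN2.
  have dw' : (normc (z - w))^-1 <= (normc z - 1)^-1.
    by rewrite lef_pV2 ?posrE//; exact: lt_le_trans dw.
  apply: (@le_trans _ _ (x * y * (normc z - 1)^-1)).
    by rewrite ler_wpM2l// mulr_ge0.
  have -> : a * x ^+ 2 + b * y ^+ 2 =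
     (normc z - 1)^-1 * (e / 2 * x ^+ 2 + e^-1 / 2 * y ^+ 2).
    by rewrite /a /b; ring.
  rewrite mulrC ler_wpM2l ?invr_ge0 ?(ltW d0)//.
  (* AM-GM: [0 <= (e x - y)^2 / (2 e)] *)
  rewrite -subr_ge0.
  have -> : e / 2 * x ^+ 2 + e^-1 / 2 * y ^+ 2 - x * y = (e * x - y) ^+ 2 / (2 * e).
    by field; rewrite gt_eqF.
  by rewrite divr_ge0 ?sqr_ge0// mulr_ge0// ltW.
rewrite RintegralD//; [|exact/disk_bounded_integrable/disk_boundedZ..].
rewrite !RintegralZl//; [|exact: disk_bounded_integrable..].
rewrite orthonormal_norm mulr1.
apply: (@le_trans _ _ (2 * (a + b * e ^+ 2))).
  by rewrite ler_wpM2l// lerD2l ler_wpM2l.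
rewrite le_eqVlt; apply/orP; left; apply/eqP; rewrite /a /b.
by field; rewrite !gt_eqF.
Qed.

(** Taking [q = 1] in the quotient identity, a zero at [z] would annihilate the denominator
    integral, against its lower bound. *)
Lemma orthonormal_exterior_neq0 n z : 1 < normc z -> (p n).[z] != 0.
Proof.
move=> z1; apply/eqP => pz.
have := @cauchy_quotient n 1 z; rewrite size_poly1 pz hornerC mul1r mul0r.
move=> /(_ isT z1) D0; have := @cauchy_denominator_ge n z z1.
by rewrite -D0 Normc.normc0 mulr0; lra.
Qed.

(** The numerator bound [2 e / (|z| - 1)] is divided by the denominator bound [1 / (2 |z|)]. *)
Lemma exterior_quotient_le n (q : {poly R[i]}) z (e : R) :
  (size q <= n.+1)%N -> 1 < normc z -> 0 < e ->
  Rintegral mu setT (fun w => normc q.[w] ^+ 2) <= e ^+ 2 ->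
  normc (q.[z] / (p n).[z]) <= 4 * e * normc z / (normc z - 1).
Proof.
move=> sq z1 e0 qe.
have pz := orthonormal_exterior_neq0 n z1.
have := cauchy_quotient sq z1.
have := cauchy_denominator_ge n z1.
have := @cauchy_numerator_le n q z e z1 e0 qe.
set A := integralC _ _; set B := integralC _ _ => hA hB E.
have B0 : B != 0.
  by apply/eqP => B0; move: hB; rewrite B0 Normc.normc0 mulr0; lra.
have -> : q.[z] / (p n).[z] = A / B.
  by apply/eqP; rewrite eqr_div// -E mulrC.
have nB : 0 < normc B.
  by rewrite lt_neqAle normc_ge0 eq_sym andbT; apply: contra B0 => /eqP/Normc.eq0_normc ->.
rewrite Normc.normcM Normc.normcV ler_pdivrMr//.
apply: le_trans hA _.
have -> : 4 * e * normc z / (normc z - 1) * normc B =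
  2 * e / (normc z - 1) * (2 * (normc z * normc B)) by ring.
rewrite ler_peMr//; last by lra.
by rewrite divr_ge0 ?mulr_ge0 ?subr_ge0 ?(ltW e0) ?(ltW z1).
Qed.

(** Subtracting [c *: p n.+1] from ['X * p n] cancels the leading terms; the remainder is orthogonal
    to [p n.+1], and only [c] times its unit norm is left. *)
Lemma lead_ratio_integral n :
  integralC mu (fun w => conjc (p n.+1).[w] * ('X * p n).[w]) =
  lead_coef (p n) / lead_coef (p n.+1).
Proof.
set c := lead_coef (p n) / lead_coef (p n.+1).
have l0 : lead_coef (p n.+1) != 0 by rewrite gt_eqF.
have sh : (size ('X * p n - c *: p n.+1)%R <= n.+1)%N.
  apply/leq_sizeP => j; rewrite leq_eqVlt => /predU1P[<-|nj].
    rewrite coefB coefZ coefXM /= /c !lead_coefE !size_p /=.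
    by move: l0; rewrite lead_coefE size_p /= => l0; rewrite divfK ?subrr.
  rewrite coefB coefZ [('X * p n)`_j]nth_default; last first.
    by rewrite mulrC size_mulX ?size_p// -size_poly_gt0 size_p.
  by rewrite nth_default ?size_p// mulr0 subr0.
rewrite (_ : (fun _ => _) = fun w =>
    conjc (p n.+1).[w] * ('X * p n - c *: p n.+1).[w]
   + c * (conjc (p n.+1).[w] * (p n.+1).[w])); last first.
  by apply/funext => w; rewrite hornerD hornerN hornerZ mulrBr [X in _ - X]mulrCA subrK.
have bp k := disk_boundedC_horner (p k).
rewrite integralCD//; last 2 first.
- by apply: bounded_conjM => //; exact: disk_boundedC_horner.
- by apply: disk_boundedC_mul; [exact: disk_boundedC_cst|exact: bounded_conjM].
rewrite orthonormal_orthogonal// add0r integralCMl//; last exact: bounded_conjM.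
by case: p_orthonormal => _ ->; rewrite eqxx mulr1.
Qed.

(** Expand the square, bound [|w p_n|] by [|p_n|] on the disk, and evaluate the cross term by
    [lead_ratio_integral]. *)
Lemma shifted_difference_norm n :
  Rintegral mu setT (fun w => normc ('X * p n - p n.+1).[w] ^+ 2) <=
  2 - 2 * Re (lead_coef (p n) / lead_coef (p n.+1)).
Proof.
have bp k := disk_boundedC_horner (p k).
have bx := disk_boundedC_horner ('X * p n).
have bc : disk_bounded (Re \o (fun w => conjc (p n.+1).[w] * ('X * p n).[w])).
  by apply: disk_bounded_Re; exact: bounded_conjM.
have b2 k := disk_bounded_normc_sqr (bp k).
have i2 k := disk_bounded_integrable mu_disk (b2 k).
apply: (@le_trans _ _ (Rintegral mu setT (fun w => normc (p n).[w] ^+ 2 +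
  (normc (p n.+1).[w] ^+ 2
    + (-2) * Re (conjc (p n.+1).[w] * ('X * p n).[w]))))).
  apply: le_Rintegral_disk => //.
  - apply: disk_bounded_normc_sqr; exact: disk_boundedC_horner.
  - by do 2 (apply: disk_boundedD => //); exact: disk_boundedZ.
  move=> w /closed_diskE w1.
  have h : normc ('X * p n).[w] ^+ 2 <= normc (p n).[w] ^+ 2.
    rewrite !hornerE Normc.normcM exprMn ler_piMl ?sqr_ge0//.
    by rewrite expr_le1 ?normc_ge0.
  move: h; rewrite hornerD hornerN !normc_sqr complex_ReM complex_ReD complex_ImD.
  case: ((p n.+1).[w]) => a b; case: (('X * p n).[w]) => c d /=; nra.
have bc2 := disk_boundedZ (-2) bc.
rewrite !RintegralD//; try exact: (disk_bounded_integrable mu_disk);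
  last by apply: disk_bounded_integrable => //; exact: disk_boundedD.
rewrite RintegralZl//; last exact: disk_bounded_integrable.
rewrite !orthonormal_norm -lead_ratio_integral /=; lra.
Qed.
End orthonormal.

(** * Compact subsets of the exterior *)

Section exterior_compact.
Variable R : realType.
Implicit Types z w : R[i].

Lemma exterior_compact_gap (K : set (riemann_sphere R)) :
  compact K -> K `<=` exterior R ->
  exists2 d : R, 0 < d & forall z, K (Some z) -> 1 + d <= normc z.
Proof.
move=> /compact_near_coveringP cK Kext.
(* The gap condition with [d = 1 / (n + 1)]. Compactness as near-covering turns its local validity
   for large [n] into validity on all of [K]. *)
pose P (n : nat) (x : riemann_sphere R) :=
  if x is Some z then (1 + n.+1%:R^-1 <= normc z : Prop) else True.
have [|n _ /(_ n (leqnn n)) nK] := cK nat \oo P _.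
  move=> [z|] Kx.
    have z1 : 1 < normc z.
      rewrite ltNge; apply/negP => /closed_diskE z1.
      by apply: (Kext _ Kx); exists z.
    (* Half of the gap at [z] absorbs the displacement from [z], the other half dominates
       [1 / (n + 1)]. *)
    have g0 : 0 < (normc z - 1) / 2 by rewrite divr_gt0// subr_gt0.
    exists (Some @` [set w | normc (w - z) < (normc z - 1) / 2],
            [set n | n.+1%:R^-1 < (normc z - 1) / 2]).
      split.
        apply: one_point_compactification_some_nbhs.
        by apply/nbhs_complexP; exists ((normc z - 1) / 2).
      exact: (near_infty_natSinv_lt (PosNum g0)).
    move=> [_ n] [/= [w /= wz <-]] ng; rewrite /P.
    have := normc_sub_ge z (z - w); rewrite subKr.
    have -> : normc (z - w) = normc (w - z) by rewrite -normcN opprB.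
    have real_bound (a b c t : R) :
      c < (a - 1) / 2 -> t < (a - 1) / 2 -> a - c <= b -> 1 + t <= b by lra.
    exact: real_bound wz ng.
  (* Off this square [|w| > 2], and [2 >= 1 + 1 / (n + 1)] for every [n]. *)
  exists (Some @` (~` complex_square 2) `|` [set None], setT).
    split => /=; last exact: filterT.
    exists (complex_square 2) => //.
    by split; [exact: compact_complex_square|exact: closed_complex_square].
  move=> [_ n] [/= [[w /= w2 <-]|->] _]; rewrite /P//.
  apply: (@le_trans _ _ 2).
    by rewrite -lerBrDl [2]/(1 + 1) addrK invf_le1// ler1n.
  have := le_Re_normc w; have := le_Im_normc w.
  have [w2'|/ltW//] := leP (normc w) 2.
  by move=> wi wr; exfalso; apply: w2; split; exact: le_trans w2'.
exists n.+1%:R^-1; first by rewrite invr_gt0.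
by move=> z /nK.
Qed.
End exterior_compact.

Theorem theorem3p4 (R : realType)
  (mu : {finite_measure set (borelC R) -> \bar R})
  (mu_compact : compact (supp mu)) (mu_infinite : infinite_set (supp mu))
  (mu_disk : supp mu `<=` closed_disk R)
  (p : nat -> {poly R[i]}) (p_orthonormal : orthonormal_polynomials mu p)
  (N : set nat) (N_infinite : infinite_set N)
  (kappa_lim : lead_coef (p n) * (lead_coef (p n.-1))^-1
                 @[n --> within N \oo] --> (1 : R[i])) :
  forall K : set (riemann_sphere R), compact K -> K `<=` exterior R ->
  {uniform K, opoly_ratio p n @[n --> within N \oo] --> cst (1 : R[i])}.
Proof.
move=> K cK Kext A /uniform_nbhs[E [entE EA]].
have [d d0 dK] := exterior_compact_gap cK Kext.
have /nbhs_complexP[e e0 eE] := nbhs_entourage (1 : R[i]) entE.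
(* Since [t / (t - 1) <= (1 + d) / d] for [t >= 1 + d], this choice gives
   [4 eps |z| / (|z| - 1) <= e / 2]. *)
pose eps := e * d / (8 * (1 + d)).
have d1 : 0 < 1 + d by rewrite addr_gt0.
have eps0 : 0 < eps by rewrite !(divr_gt0, mulr_gt0).
have kappa_inv : lead_coef (p n.-1) / lead_coef (p n)
    @[n --> within N \oo] --> (1 : R[i]).
  rewrite -[X in _ --> X]invr1.
  under eq_fun do rewrite -[_ / _]invrK invfM invrK mulrC.
  by apply: cvgV => //; rewrite oner_eq0.
(* The bound [e] settles the point at infinity, where the ratio is [kappa_{n-1} / kappa_n] itself;
   [eps ^+ 2 / 2] makes [2 - 2 k_n] at most [eps ^+ 2]. *)
pose c := Num.min e (eps ^+ 2 / 2).
have c0 : 0 < c by rewrite lt_min e0 divr_gt0 ?exprn_gt0.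
have /kappa_inv kc : nbhs (1 : R[i]) [set w | normc (w - 1) < c].
  by apply/nbhs_complexP; exists c.
(* Excludes [n = 0], where [n.-1 = n] and the ratio is not the intended one. *)
have n0 : \forall n \near within N \oo, (0 < n)%N.
  by apply: cvg_within; exact: nbhs_infty_gt.
suff H : \forall n \near within N \oo, forall y, K y -> E (1, opoly_ratio p n y).
  by apply: filterS H => n; exact: EA.
apply: filterS2 n0 kc => -[//|n] _ /= kn [z|] Ky; apply/xsectionP/eE; last first.
  by apply: lt_le_trans kn _; rewrite ge_min lexx.
have z1 := dK _ Ky.
have z1' : 1 < normc z by apply: lt_le_trans z1; rewrite ltrDl.
have pz := orthonormal_exterior_neq0 mu_disk p_orthonormal n.+1 z1'.
have -> : opoly_ratio p n.+1 (Some z) - 1 = ('X * p n - p n.+1).[z] / (p n.+1).[z].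
  by rewrite hornerD hornerN hornerM hornerX mulrBl divff.
have size_p k : size (p k) = k.+1 by case: p_orthonormal => /(_ k)[].
have sq : (size ('X * p n - p n.+1)%R <= n.+2)%N.
  apply: leq_trans (size_polyD _ _) _; rewrite size_polyN geq_max size_p leqnn andbT.
  by rewrite mulrC size_mulX ?size_p// -size_poly_gt0 size_p.
apply: le_lt_trans (exterior_quotient_le mu_disk p_orthonormal sq z1' eps0 _) _.
  apply: le_trans (shifted_difference_norm mu_disk p_orthonormal n) _.
  have := le_trans (ler_norm _) (le_Re_normc (1 - lead_coef (p n) / lead_coef (p n.+1))).
  move: kn; rewrite -[normc _]normcN opprB lt_min => /andP[_].
  rewrite complex_ReD /=; case: (_ / _) => a b /=; lra.
rewrite ltr_pdivrMr ?subr_gt0// /eps.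
have -> : 4 * (e * d / (8 * (1 + d))) * normc z = e * (d * normc z / (2 * (1 + d))).
  by field; rewrite gt_eqF.
(* What remains is [d t < 2 (1 + d) (t - 1)] for [t = |z| >= 1 + d]; the difference of the two sides
   is at least [d (1 + d)]. *)
rewrite ltr_pM2l// ltr_pdivrMr ?mulr_gt0//; nra.
Qed.
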